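(* For every density matrix $\rho_{AB}$ on a finite-dimensional space $\mathcal H_A\otimes\mathcal H_B$, $\mu_{\mathrm{ent}}(\rho_{AB})=0$ if and only if $\rho_{AB}$ is separable, i.e., $\rho_{AB}=\sum_i p_i\,\tau_A^{(i)}\otimes\tau_B^{(i)}$ for some probability weights $p_i$ and density matrices $\tau_A^{(i)},\tau_B^{(i)}$.
   Context: For a bipartite density matrix $\rho_{AB}$ with reduced states $\rho_A,\rho_B$, the maximal correlation is $\mu(\rho_{AB})=\max |\mathrm{tr}(\rho_{AB}\, X_A\otimes Y_B^\dagger)|$ over $X_A\in\mathbf L(\mathcal H_A)$, $Y_B\in\mathbf L(\mathcal H_B)$ with $\mathrm{tr}(\rho_A X_A)=\mathrm{tr}(\rho_B Y_B)=0$ and $\mathrm{tr}(\rho_A X_AX_A^\dagger)=\mathrm{tr}(\rho_B Y_BY_B^\dagger)=1$. The maximal entanglement is $\mu_{\mathrm{ent}}(\rho_{AB})=\inf \max_i \mu(\tau^{(i)}_{AB})$, the infimum over all decompositions $\rho_{AB}=\sum_i p_i\tau^{(i)}_{AB}$ with $p_i\ge0$ and $\tau^{(i)}_{AB}$ density matrices. *)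

(* Defs.v *)
From HB Require Import structures.
From mathcomp Require Import all_boot all_order all_algebra.
From mathcomp Require Import complex mxtens.
From mathcomp Require Import boolp classical_sets reals.

Set Implicit Arguments.
Unset Strict Implicit.
Unset Printing Implicit Defensive.

Import Order.TTheory GRing.Theory Num.Theory.
Local Open Scope ring_scope.
Local Open Scope classical_set_scope.

Section QInfo.
Variable R : realType.
Local Notation C := R[i].

Definition mxdag (m n : nat) (A : 'M[C]_(m, n)) : 'M[C]_(n, m) :=
  (map_mx Num.conj A)^T.

(* positive semidefinite: <v, A v> >= 0 for every vector v (over C,
   0 <= z forces z to be real, so this includes hermiticity) *)
Definition psd (n : nat) (A : 'M[C]_n) : Prop :=
  forall v : 'cV[C]_n, 0 <= (mxdag v *m A *m v) 0 0.

Definition density (n : nat) (A : 'M[C]_n) : Prop := psd A /\ \tr A = 1.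

(* the composite index (i,k) of H_A (x) H_B is mxtens_index (i,k), the
   same convention used by the Kronecker product  A *t B  of mxtens *)
Definition ptraceB (dA dB : nat) (rho : 'M[C]_(dA * dB)) : 'M[C]_dA :=
  \matrix_(i, j) \sum_(k < dB) rho (mxtens_index (i, k)) (mxtens_index (j, k)).

Definition ptraceA (dA dB : nat) (rho : 'M[C]_(dA * dB)) : 'M[C]_dB :=
  \matrix_(i, j) \sum_(k < dA) rho (mxtens_index (k, i)) (mxtens_index (k, j)).

(* maximal correlation mu(rho_AB): the maximum (= supremum, the feasible
   values being bounded) of |tr(rho X_A (x) Y_B^dagger)| over the
   normalized, centered X_A, Y_B. *)
Definition maxcorr (dA dB : nat) (rho : 'M[C]_(dA * dB)) : R :=
  let rhoA := ptraceB rho in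
  let rhoB := ptraceA rho in
  sup [set r : R | exists (X : 'M[C]_dA) (Y : 'M[C]_dB),
         [/\ \tr (rhoA *m X) = 0, \tr (rhoB *m Y) = 0,
             \tr (rhoA *m (X *m mxdag X)) = 1,
             \tr (rhoB *m (Y *m mxdag Y)) = 1 &
             r = complex.Re `|\tr (rho *m (X *t mxdag Y))| ] ].

Definition maxent (dA dB : nat) (rho : 'M[C]_(dA * dB)) : R :=
  inf [set r : R | exists (n : nat) (p : 'I_n -> R) (tau : 'I_n -> 'M[C]_(dA * dB)),
         [/\ forall i, 0 <= p i,
             forall i, density (tau i),
             rho = \sum_(i < n) (p i)%:C%C *: tau i &
             r = \big[Num.max/0]_(i < n) maxcorr (tau i) ] ].

Definition separable (dA dB : nat) (rho : 'M[C]_(dA * dB)) : Prop :=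
  exists (n : nat) (p : 'I_n -> R) (tauA : 'I_n -> 'M[C]_dA)
         (tauB : 'I_n -> 'M[C]_dB),
    [/\ forall i, 0 <= p i,
        \sum_(i < n) p i = 1,
        forall i, density (tauA i),
        forall i, density (tauB i) &
        rho = \sum_(i < n) (p i)%:C%C *: (tauA i *t tauB i)].

End QInfo.

(* Main.v *)
Require Import Defs.
From HB Require Import structures.
From mathcomp Require Import all_boot all_order all_algebra.
From mathcomp Require Import complex mxtens ring lra spectral.
From mathcomp Require Import boolp classical_sets filter reals.

Set Implicit Arguments.
Unset Strict Implicit.
Unset Printing Implicit Defensive.

Import Order.TTheory GRing.Theory Num.Theory.
Local Open Scope ring_scope.

(** The entries of [tau - tau_A (x) tau_B] are covariances of matrix units, so
    Cauchy-Schwarz for the form [tr (U^dagger tau V)] bounds each of them by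
    [maxcorr tau]; in particular [maxcorr] vanishes only on product states.  If
    [maxent rho = 0], replacing every [tau_i] of a good decomposition of [rho] by
    the product of its marginals gives separable matrices arbitrarily close to
    [rho].  By Caratheodory's theorem these need only a bounded number of product
    terms, so the weights and the entries of the factors have limits along an
    ultrafilter, and these limits exhibit [rho] as separable.  Conversely,
    product states have [maxcorr] zero. *)

(** The values at [(1, 1)] and [(1, 'i)] are real, which forces hermiticity; one further well-chosen
    vector gives the determinant inequality. This two-dimensional case is the source of both
    hermiticity and Cauchy-Schwarz below. *)
Lemma psd_form2 (C : numClosedFieldType) (a b c d : C) :
  (forall s t : C, 0 <= s^* * s * a + s^* * t * b + t^* * s * c + t^* * t * d) ->
  c = b^* /\ `|b| ^+ 2 <= a * d.
Proof.
move=> H.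
have a0 : 0 <= a.
  by have := H 1 0; rewrite conjC0 conjC1 !(mulr0, mul0r, mul1r, addr0).
have d0 : 0 <= d.
  by have := H 0 1; rewrite conjC0 conjC1 !(mulr0, mul0r, mul1r, addr0, add0r).
have aR : a^* = a by apply: conj_Creal; rewrite ger0_real.
have dR : d^* = d by apply: conj_Creal; rewrite ger0_real.
have cE : c = b^*.
  have h1 : b^* + c^* = b + c.
    have := conj_Creal (ger0_real (H 1 1)).
    rewrite conjC1 !mul1r !rmorphD /= aR dR => /(addIr d).
    by rewrite -!addrA => /(addrI a).
  have h2 : 'i * (c^* - b^*) = 'i * (b - c).
    have := conj_Creal (ger0_real (H 1 'i)).
    rewrite !(rmorphD, rmorphM) /= !conjC1 !conjCi rmorphN /= conjCi aR dR.
    by move=> /eqP; rewrite -subr_eq0 => /eqP e; apply/subr0_eq; rewrite -e; ring.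
  have := mulfI (neq0Ci C) h2 => {}h2.
  have : c^* *+ 2 = b *+ 2.
    have -> : c^* *+ 2 = (b^* + c^*) + (c^* - b^*) by ring.
    by rewrite h1 h2; ring.
  by move=> /(pmulrnI (isT : (0 < 2)%N)) <-; rewrite conjCK.
split => //; subst c.
have nb : `|b| ^+ 2 = b * b^* by rewrite normCK.
have [d_eq0|dn0] := eqVneq d 0.
  rewrite d_eq0 mulr0; have [->|bn0] := eqVneq b 0; first by rewrite normr0 expr0n.
  have n0 : 0 < `|b| ^+ 2 by rewrite exprn_gt0 // normr_gt0.
  set r := (a + 1) / `|b| ^+ 2.
  have rR : r^* = r.
    by apply/conj_Creal/ger0_real/divr_ge0; [exact: addr_ge0 | exact: ltW].
  have := H 1 (- (r * b^*)); rewrite d_eq0 conjC1 rmorphN rmorphM /= conjCK rR.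
  have -> : 1 * 1 * a + 1 * - (r * b^*) * b + - (r * b) * 1 * b^*
    + - (r * b) * - (r * b^*) * 0 = a - (r * `|b| ^+ 2) *+ 2 by rewrite nb; ring.
  rewrite divfK ?gt_eqF // subr_ge0 => h.
  suff : a < (a + 1) *+ 2 by move/lt_le_trans/(_ h); rewrite ltxx.
  by rewrite mulr2n -addrA ltrDl ltr_wpDr ?addr_ge0// addr_ge0.
have dp : 0 < d by rewrite lt_def dn0.
(* For [s = d] this [t] minimises the form, and the minimum is [d] times the determinant. *)
have := H d (- b^*); rewrite dR rmorphN /= conjCK.
have -> : d * d * a + d * - b^* * b + - b * d * b^* + - b * - b^* * d =
   d * (a * d - `|b| ^+ 2) by rewrite nb; ring.
by rewrite pmulr_rge0 // subr_ge0.
Qed.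

(** * Positive semidefinite matrices and density matrices *)

Section States.
Variable R : realType.
Local Notation C := R[i].
Local Notation dag := (@mxdag R _ _).

Lemma mxdagE m n (A : 'M[C]_(m, n)) i j : dag A i j = (A j i)^*.
Proof. by rewrite !mxE. Qed.

Lemma mxdagK m n : cancel (@mxdag R m n) (@mxdag R n m).
Proof. by move=> A; apply/matrixP => i j; rewrite !mxdagE conjCK. Qed.

Lemma mxdagM m n p (A : 'M[C]_(m, n)) (B : 'M[C]_(n, p)) :
  dag (A *m B) = dag B *m dag A.
Proof. by rewrite /mxdag map_mxM trmx_mul. Qed.

Lemma mxdagD m n (A B : 'M[C]_(m, n)) : dag (A + B) = dag A + dag B.
Proof. by rewrite /mxdag map_mxD linearD. Qed.

Lemma mxdagB m n (A B : 'M[C]_(m, n)) : dag (A - B) = dag A - dag B.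
Proof. by rewrite /mxdag map_mxB linearB. Qed.

Lemma mxdagZ m n (s : C) (A : 'M[C]_(m, n)) : dag (s *: A) = s^* *: dag A.
Proof. by apply/matrixP => i j; rewrite !mxE rmorphM. Qed.

Lemma mxdag_scalar n (s : C) : dag (s%:M : 'M_n) = s^*%:M.
Proof. by rewrite /mxdag map_scalar_mx tr_scalar_mx. Qed.

Lemma mxdag_tens m n p q (A : 'M[C]_(m, n)) (B : 'M[C]_(p, q)) :
  dag (A *t B) = dag A *t dag B.
Proof. by rewrite /mxdag map_mxT trmx_tens. Qed.

Lemma mxtrace_dag n (A : 'M[C]_n) : \tr (dag A) = (\tr A)^*.
Proof. by rewrite /mxtrace rmorph_sum; apply: eq_bigr => i _; rewrite mxdagE. Qed.

Lemma dag_mulmx_ge0 m (v : 'cV[C]_m) : 0 <= (dag v *m v) 0 0.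
Proof.
by rewrite mxE sumr_ge0 // => i _; rewrite mxdagE mulrC mul_conjC_ge0.
Qed.

Lemma psd_trace_ge0 n m (A : 'M[C]_n) (U : 'M[C]_(n, m)) :
  psd A -> 0 <= \tr (dag U *m A *m U).
Proof.
move=> psdA; apply: sumr_ge0 => i _.
have := psdA (col i U); congr (0 <= _).
rewrite !mxE; apply: eq_bigr => k _; rewrite !mxE; congr (_ * _).
by apply: eq_bigr => l _; rewrite !mxE.
Qed.

(** Positivity at [s U + t V], expanded in [s] and [t], is the hypothesis of [psd_form2].
    Rectangular [U], [V] cover both basis columns, which give matrix entries, and operators, which
    give correlations. *)
Lemma psd_trace_form n m (A : 'M[C]_n) (U V : 'M[C]_(n, m)) :
  psd A -> \tr (dag V *m A *m U) = (\tr (dag U *m A *m V))^* /\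
    `|\tr (dag U *m A *m V)| ^+ 2 <=
      \tr (dag U *m A *m U) * \tr (dag V *m A *m V).
Proof.
move=> psdA; apply: psd_form2 => s t.
have formr (W : 'M[C]_(m, n)) :
    \tr (W *m (s *: U + t *: V)) = s * \tr (W *m U) + t * \tr (W *m V).
  by rewrite mulmxDr mxtraceD -!scalemxAr !mxtraceZ.
have forml (W : 'M[C]_(n, m)) : \tr (dag (s *: U + t *: V) *m W) =
    s^* * \tr (dag U *m W) + t^* * \tr (dag V *m W).
  by rewrite mxdagD !mxdagZ mulmxDl mxtraceD -!scalemxAl !mxtraceZ.
have := psd_trace_ge0 (s *: U + t *: V) psdA.
rewrite formr -!mulmxA !forml !mulmxA; congr (0 <= _); ring.
Qed.

Lemma mxtrace11 (M : 'M[C]_1) : \tr M = M 0 0.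
Proof. by rewrite /mxtrace big_ord1. Qed.

Lemma form_delta n (A : 'M[C]_n) i j :
  \tr (dag (delta_mx i 0 : 'cV[C]_n) *m A *m (delta_mx j 0 : 'cV[C]_n)) = A i j.
Proof.
have -> : dag (delta_mx i 0 : 'cV[C]_n) = delta_mx 0 i.
  by apply/matrixP => k l; rewrite !mxE !ord1 andbC rmorph_nat.
by rewrite -rowE -colE mxtrace11 !mxE.
Qed.

Lemma psd_herm n (A : 'M[C]_n) : psd A -> dag A = A.
Proof.
move=> psdA; apply/matrixP => i j; rewrite mxdagE.
by have [] := psd_trace_form (delta_mx i 0 : 'cV_n) (delta_mx j 0 : 'cV_n) psdA;
  rewrite !form_delta => -> _; rewrite conjCK.
Qed.

Lemma psd_diag_ge0 n (A : 'M[C]_n) i : psd A -> 0 <= A i i.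
Proof. by move=> /(psd_trace_ge0 (delta_mx i 0 : 'cV_n)); rewrite form_delta. Qed.

Lemma density_diag_le1 n (A : 'M[C]_n) i : density A -> A i i <= 1.
Proof.
move=> [psdA <-]; rewrite /mxtrace (bigD1 i) //= lerDl sumr_ge0 // => j _.
exact: psd_diag_ge0.
Qed.

(** Cauchy-Schwarz on basis vectors bounds an entry by two diagonal ones. This boundedness is what
    later yields limits of density matrices. *)
Lemma density_entry_le1 n (A : 'M[C]_n) i j : density A -> `|A i j| <= 1.
Proof.
move=> dA; have [psdA _] := dA.
have [_] := psd_trace_form (delta_mx i 0 : 'cV_n) (delta_mx j 0 : 'cV_n) psdA.
rewrite !form_delta => h; rewrite -(@expr_le1 _ 2%N) //; apply: le_trans h _.
by rewrite mulr_ile1 ?psd_diag_ge0 ?density_diag_le1.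
Qed.

Lemma psd_conj m n (A : 'M[C]_m) (U : 'M[C]_(m, n)) :
  psd A -> psd (dag U *m A *m U).
Proof. by move=> psdA v; have := psdA (U *m v); rewrite mxdagM !mulmxA. Qed.

(** By the spectral theorem [A] is [dag P *m diag_mx D *m P] with [D] nonnegative, so [M] is the
    root of the diagonal part times [P]. Such factorisations are compatible with Kronecker products,
    hence [psd_tens]. *)
Lemma psd_factor n (A : 'M[C]_n) : psd A -> exists M : 'M[C]_n, A = dag M *m M.
Proof.
move=> psdA; have hA := psd_herm psdA.
have nA : A \is normalmx.
  by apply/normalmxP; have := hA; rewrite /mxdag map_trmx => ->.
have uP := spectral_unitarymx A; set P := spectralmx A in uP.
have iP : invmx P = dag P by rewrite invmx_unitary // /mxdag map_trmx.
have uU : P \in unitmx by exact: unitarymx_unit.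
have /orthomx_spectralP := nA; rewrite -/P iP; set D := spectral_diag A => eA.
have D_ge0 i : 0 <= D 0 i.
  suff : psd (diag_mx D) by move=> /(psd_diag_ge0 i); rewrite mxE eqxx.
  have -> : diag_mx D = dag (dag P) *m A *m dag P.
    by rewrite mxdagK -iP eA -iP !mulmxA mulmxV // mul1mx mulmxK.
  exact: psd_conj.
exists (diag_mx (map_mx sqrtC D) *m P).
rewrite mxdagM !mulmxA -[_ *m diag_mx _]mulmxA {1}eA; congr (_ *m _ *m _).
rewrite /mxdag map_diag_mx tr_diag_mx mulmx_diag; congr diag_mx.
apply/rowP => i; rewrite !mxE /= conj_Creal ?ger0_real ?sqrtC_ge0 //.
by rewrite -expr2 sqrtCK.
Qed.

Lemma psd_dag_mulmx m n (M : 'M[C]_(m, n)) : psd (dag M *m M).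
Proof.
by move=> v; rewrite mulmxA -mulmxA -mxdagM dag_mulmx_ge0.
Qed.

Lemma psd_tens m n (A : 'M[C]_m) (B : 'M[C]_n) : psd A -> psd B -> psd (A *t B).
Proof.
move=> /psd_factor[M ->] /psd_factor[N ->].
by rewrite -tensmx_mul -mxdag_tens; exact: psd_dag_mulmx.
Qed.

Lemma mxtrace_tens m n (A : 'M[C]_m) (B : 'M[C]_n) :
  \tr (A *t B) = \tr A * \tr B.
Proof.
rewrite /mxtrace mulr_sum; apply: eq_bigr => k _.
by case: (mxtens_indexP k) => i j; rewrite tensmxE mxtens_indexK.
Qed.

Lemma density_tens m n (A : 'M[C]_m) (B : 'M[C]_n) :
  density A -> density B -> density (A *t B).
Proof.
by move=> [pA tA] [pB tB]; split; [exact: psd_tens|rewrite mxtrace_tens tA tB mulr1].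
Qed.

End States.

(** * Kronecker products, partial traces and the Cauchy-Schwarz bound on correlations *)

Section Correlation.
Variable R : realType.
Local Notation C := R[i].
Local Notation dag := (@mxdag R _ _).

Lemma tensmxZl m n p q (s : C) (A : 'M[C]_(m, n)) (D : 'M[C]_(p, q)) :
  (s *: A) *t D = s *: (A *t D).
Proof. by apply/matrixP => i j; rewrite !mxE mulrA. Qed.

Lemma tensmxZr m n p q (s : C) (A : 'M[C]_(m, n)) (D : 'M[C]_(p, q)) :
  D *t (s *: A) = s *: (D *t A).
Proof. by apply/matrixP => i j; rewrite !mxE mulrCA. Qed.

Lemma mxtens_index_eq m n (i j : 'I_m) (k l : 'I_n) :
  (mxtens_index (i, k) == mxtens_index (j, l)) = (i == j) && (k == l).
Proof. by rewrite (can_eq (@mxtens_indexK _ _)). Qed.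

Lemma tens1mx1 m n : (1%:M : 'M[C]_m) *t (1%:M : 'M[C]_n) = 1%:M.
Proof.
apply/matrixP => a b; case: (mxtens_indexP a) => i k; case: (mxtens_indexP b) => j l.
by rewrite tensmxE !mxE mxtens_index_eq -natrM mulnb.
Qed.

Lemma tensmx_centered m n (X : 'M[C]_m) (Y : 'M[C]_n) (x y : C) :
  (X - x%:M) *t (Y - y%:M) =
    X *t Y - y *: (X *t 1%:M) - x *: (1%:M *t Y) + (x * y)%:M.
Proof.
apply/matrixP => a b; case: (mxtens_indexP a) => i k; case: (mxtens_indexP b) => j l.
rewrite tensmxE !mxE !mxtens_indexK /= mxtens_index_eq.
by case: (i == j); case: (k == l); rewrite ?mulr1n ?mulr0n; ring.
Qed.

Lemma sum_mxtens_index m n (F : 'I_(m * n) -> C) :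
  \sum_a F a = \sum_i \sum_k F (mxtens_index (i, k)).
Proof.
rewrite pair_big (reindex (@mxtens_index m n)) /=.
  by apply: eq_bigr => -[].
by exists (@mxtens_unindex m n) => a _; rewrite ?mxtens_indexK ?mxtens_unindexK.
Qed.

Section PartialTraces.
Variables (dA dB : nat).
Implicit Types (rho : 'M[C]_(dA * dB)) (X : 'M[C]_dA) (Y : 'M[C]_dB).

(** The defining duality of the partial trace; positivity and normalisation of the marginal follow
    from it. *)
Lemma mxtrace_ptraceB rho X : \tr (ptraceB rho *m X) = \tr (rho *m (X *t 1%:M)).
Proof.
rewrite /mxtrace sum_mxtens_index; apply: eq_bigr => i _.
transitivity (\sum_k \sum_j rho (mxtens_index (i, k)) (mxtens_index (j, k)) * X j i).
  rewrite exchange_big mxE; apply: eq_bigr => j _.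
  by rewrite mxE mulr_suml.
apply: eq_bigr => k _; rewrite mxE sum_mxtens_index; apply: eq_bigr => j _.
rewrite (bigD1 k) //= tensmxE !mxE eqxx mulr1 big1 ?addr0 // => l lk.
by rewrite tensmxE !mxE (negbTE lk) !mulr0.
Qed.

Lemma mxtrace_ptraceA rho Y : \tr (ptraceA rho *m Y) = \tr (rho *m (1%:M *t Y)).
Proof.
rewrite /mxtrace sum_mxtens_index exchange_big /=; apply: eq_bigr => k _.
transitivity (\sum_i \sum_l rho (mxtens_index (i, k)) (mxtens_index (i, l)) * Y l k).
  rewrite exchange_big mxE; apply: eq_bigr => l _.
  by rewrite mxE mulr_suml.
apply: eq_bigr => i _; rewrite mxE sum_mxtens_index exchange_big.
apply: eq_bigr => l _.
rewrite (bigD1 i) //= tensmxE !mxE eqxx mul1r big1 ?addr0 // => j ji.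
by rewrite tensmxE !mxE (negbTE ji) mul0r mulr0.
Qed.

Lemma psd_trace_mul_ge0 m n (A : 'M[C]_m) (U : 'M[C]_(m, n)) :
  psd A -> 0 <= \tr (A *m (U *m dag U)).
Proof. by move=> /(psd_trace_ge0 U); rewrite -mulmxA mxtrace_mulC -mulmxA. Qed.

(** By duality the form at [v] is the trace of [rho] against [(v *m dag v) *t 1], which again has
    the shape [W *m dag W]. *)
Lemma psd_ptraceB rho : psd rho -> psd (ptraceB rho).
Proof.
move=> psdr v; rewrite -mxtrace11 -mulmxA mxtrace_mulC -mulmxA mxtrace_ptraceB.
have -> : (v *m dag v) *t (1%:M : 'M[C]_dB) = (v *t 1%:M) *m dag (v *t 1%:M).
  by rewrite mxdag_tens tensmx_mul mxdag_scalar conjC1 mulmx1.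
exact: psd_trace_mul_ge0.
Qed.

Lemma psd_ptraceA rho : psd rho -> psd (ptraceA rho).
Proof.
move=> psdr v; rewrite -mxtrace11 -mulmxA mxtrace_mulC -mulmxA mxtrace_ptraceA.
have -> : (1%:M : 'M[C]_dA) *t (v *m dag v) = (1%:M *t v) *m dag (1%:M *t v).
  by rewrite mxdag_tens tensmx_mul mxdag_scalar conjC1 mulmx1.
exact: psd_trace_mul_ge0.
Qed.

Lemma density_ptraceB rho : density rho -> density (ptraceB rho).
Proof.
move=> [psdr trr]; split; first exact: psd_ptraceB.
by rewrite -[ptraceB _]mulmx1 mxtrace_ptraceB tens1mx1 mulmx1.
Qed.

Lemma density_ptraceA rho : density rho -> density (ptraceA rho).
Proof.
move=> [psdr trr]; split; first exact: psd_ptraceA.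
by rewrite -[ptraceA _]mulmx1 mxtrace_ptraceA tens1mx1 mulmx1.
Qed.

Lemma ptraceB_tens X Y : ptraceB (X *t Y) = \tr Y *: X.
Proof.
apply/matrixP => i j; rewrite !mxE mulrC /mxtrace mulr_sumr.
by apply: eq_bigr => k _; rewrite tensmxE.
Qed.

(* Cauchy-Schwarz for the semi-inner product [tr (U^dagger rho V)], applied to
   [U = 1 (x) Y] and [V = X (x) 1]. *)
Lemma corr_Cauchy_Schwarz rho X Y : psd rho ->
  `|\tr (rho *m (X *t dag Y))| ^+ 2 <=
    \tr (ptraceB rho *m (X *m dag X)) * \tr (ptraceA rho *m (Y *m dag Y)).
Proof.
move=> psdr; have [_] := psd_trace_form (1%:M *t Y) (X *t 1%:M) psdr.
rewrite !(mxtrace_ptraceA, mxtrace_ptraceB) !mxdag_tens !mxdag_scalar conjC1.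
have cyc (U V : 'M[C]_(dA * dB)) : \tr (U *m rho *m V) = \tr (rho *m (V *m U)).
  by rewrite -mulmxA mxtrace_mulC mulmxA.
by rewrite 3!cyc 3!tensmx_mul !(mul1mx, mulmx1) [X in _ <= X]mulrC.
Qed.

End PartialTraces.
End Correlation.

(** * Maximal correlation: entrywise control and vanishing on product states *)

Section MaximalCorrelation.
Variable R : realType.
Local Notation C := R[i].
Local Notation dag := (@mxdag R _ _).

Lemma Re_norm (z : C) : (complex.Re `|z|)%:C%C = `|z|.
Proof. by apply: RRe_real; rewrite normr_real. Qed.

Lemma Re_norm_ge0 (z : C) : 0 <= complex.Re `|z|.
Proof. by rewrite -lecR Re_norm normr_ge0. Qed.

Section Bipartite.
Variables (dA dB : nat).
Implicit Types (rho : 'M[C]_(dA * dB)) (X : 'M[C]_dA) (Y : 'M[C]_dB).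

Lemma maxcorr_ge0 rho : 0 <= maxcorr rho.
Proof.
rewrite /maxcorr; set S := (X in sup X).
(* The feasible set may be empty, for instance for a state with [dA = 1], where a centered [X] is
   zero; [sup] then takes its default value 0. *)
have [[r Sr] | /set0P/negP/negPn/eqP ->] := pselect (S !=set0)%classic; last by rewrite sup0.
have [hS | nS] := pselect (has_sup S); last by rewrite sup_out.
by apply: le_trans (ub_le_sup hS.2 Sr); case: Sr => X [Y [_ _ _ _ ->]]; exact: Re_norm_ge0.
Qed.

(** By Cauchy-Schwarz the feasible values are at most 1, so the supremum is a genuine upper
    bound. *)
Lemma norm_corr_le_maxcorr rho X Y : psd rho ->
  \tr (ptraceB rho *m X) = 0 -> \tr (ptraceA rho *m Y) = 0 ->
  \tr (ptraceB rho *m (X *m dag X)) = 1 -> \tr (ptraceA rho *m (Y *m dag Y)) = 1 ->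
  `|\tr (rho *m (X *t dag Y))| <= (maxcorr rho)%:C%C.
Proof.
move=> psdr tX tY vX vY; rewrite -Re_norm lecR; apply: ub_le_sup; last first.
  by exists X, Y.
exists 1 => _ [X' [Y' [_ _ vX' vY' ->]]]; rewrite -lecR Re_norm.
rewrite -(@expr_le1 _ 2%N) // (le_trans (corr_Cauchy_Schwarz _ _ psdr)) //.
by rewrite vX' vY' mulr1.
Qed.

(** Homogeneous form, free of the unit variance constraint: [X] and [Y] are divided by their
    standard deviations, and if a variance vanishes plain Cauchy-Schwarz already gives 0. *)
Lemma corr_le_maxcorr rho X Y : psd rho ->
  \tr (ptraceB rho *m X) = 0 -> \tr (ptraceA rho *m Y) = 0 ->
  `|\tr (rho *m (X *t dag Y))| ^+ 2 <= (maxcorr rho)%:C%C ^+ 2 *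
    (\tr (ptraceB rho *m (X *m dag X)) * \tr (ptraceA rho *m (Y *m dag Y))).
Proof.
move=> psdr tX tY; have := corr_Cauchy_Schwarz X Y psdr.
have := psd_trace_mul_ge0 X (psd_ptraceB psdr).
have := psd_trace_mul_ge0 Y (psd_ptraceA psdr).
set s := \tr (ptraceB rho *m _); set t := \tr (ptraceA rho *m _) => t0 s0.
have [->|sn0] := eqVneq s 0; first by rewrite mul0r mulr0.
have [->|tn0] := eqVneq t 0; first by rewrite !mulr0.
move=> _; set a := sqrtC s; set b := sqrtC t.
have a2 : a ^+ 2 = s by rewrite sqrtCK.
have b2 : b ^+ 2 = t by rewrite sqrtCK.
have ap : 0 < a by rewrite sqrtC_gt0 lt_def sn0.
have bp : 0 < b by rewrite sqrtC_gt0 lt_def tn0.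
have aJ : (a^-1)^* = a^-1 by rewrite conj_Creal // ger0_real // invr_ge0 ltW.
have bJ : (b^-1)^* = b^-1 by rewrite conj_Creal // ger0_real // invr_ge0 ltW.
have := @norm_corr_le_maxcorr rho (a^-1 *: X) (b^-1 *: Y) psdr.
rewrite !mxdagZ aJ bJ -!(scalemxAl, scalemxAr) !mxtraceZ tX tY !mulr0 -/s -/t.
have -> : a^-1 * (a^-1 * s) = 1 by rewrite -a2 expr2 mulKf ?gt_eqF // mulVf ?gt_eqF.
have -> : b^-1 * (b^-1 * t) = 1 by rewrite -b2 expr2 mulKf ?gt_eqF // mulVf ?gt_eqF.
move=> /(_ erefl erefl erefl erefl).
rewrite tensmxZl tensmxZr -!scalemxAr !mxtraceZ !normrM.
rewrite !(gtr0_norm (_ : 0 < _^-1)) ?invr_gt0 // => h.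
set T := `|_| in h *; have T0 : 0 <= a^-1 * (b^-1 * T).
  by rewrite !mulr_ge0 ?normr_ge0 ?invr_ge0 ?ltW.
have -> : T = a^-1 * (b^-1 * T) * (a * b) by field; rewrite !gt_eqF.
move: (a^-1 * _) h T0 => q h q0; rewrite -a2 -b2 -[a ^+ 2 * _]exprMn [leLHS]exprMn.
apply: ler_wpM2r; first by rewrite exprn_ge0 // mulr_ge0 ?ltW.
by rewrite ler_sqr // nnegrE (le_trans q0).
Qed.

Lemma variance_centered n (sigma X : 'M[C]_n) (a := \tr (sigma *m X)) :
  density sigma ->
  \tr (sigma *m ((X - a%:M) *m dag (X - a%:M))) =
    \tr (sigma *m (X *m dag X)) - `|a| ^+ 2.
Proof.
move=> [psds trs]; have aJ : \tr (sigma *m dag X) = a^*.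
  by rewrite /a -mxtrace_dag mxdagM (psd_herm psds) mxtrace_mulC.
rewrite mxdagB mxdag_scalar mulmxBl !mulmxBr !mul_scalar_mx !mul_mx_scalar.
rewrite scale_scalar_mx -!scalemxAr !(raddfB, raddfD) /= !mxtraceZ -/a aJ.
rewrite mul_mx_scalar mxtraceZ trs mulr1 normCK; ring.
Qed.

Lemma mxtrace_mul_delta n (A : 'M[C]_n) i j : \tr (A *m delta_mx i j) = A j i.
Proof.
rewrite /mxtrace (bigD1 j) //= big1 => [|k kj]; rewrite mxE.
  rewrite (bigD1 i) //= mxE !eqxx mulr1 big1 ?addr0 // => l li.
  by rewrite mxE (negbTE li) mulr0.
by rewrite big1 // => l _; rewrite mxE (negbTE kj) andbF mulr0.
Qed.

Lemma delta_mx_tens m n p q (i : 'I_m) (j : 'I_n) (k : 'I_p) (l : 'I_q) :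
  delta_mx i j *t delta_mx k l =
    delta_mx (mxtens_index (i, k)) (mxtens_index (j, l)) :> 'M[C]_(_, _).
Proof.
apply/matrixP => a b; case: (mxtens_indexP a) => i' k'.
case: (mxtens_indexP b) => j' l'.
by rewrite tensmxE !mxE !mxtens_index_eq -natrM mulnb andbACA.
Qed.

(** The second moment of this matrix unit is the diagonal entry [sigma i i], and centering only
    lowers it. *)
Lemma variance_delta_le1 n (sigma : 'M[C]_n) i j (X := delta_mx i j)
    (a := \tr (sigma *m X)) : density sigma ->
  \tr (sigma *m ((X - a%:M) *m dag (X - a%:M))) <= 1.
Proof.
move=> ds; rewrite variance_centered // lerBlDr.
have -> : dag X = delta_mx j i.
  by apply/matrixP => k l; rewrite !mxE andbC rmorph_nat.
rewrite mul_delta_mx mxtrace_mul_delta.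
by rewrite (le_trans (density_diag_le1 i ds)) // lerDl exprn_ge0.
Qed.

Lemma maxcorr_entry rho a b : density rho ->
  `|rho a b - (ptraceB rho *t ptraceA rho) a b| <= (maxcorr rho)%:C%C.
Proof.
move=> dr; have [psdr trr] := dr.
have dsA := density_ptraceB dr; have dsB := density_ptraceA dr.
case: (mxtens_indexP a) => i k; case: (mxtens_indexP b) => j l.
(* The trace against [delta_mx j i] reads off entry [(i, j)]. On the second factor the dagger swaps
   the indices, so the observable there is [delta_mx k l]. *)
set x := \tr (ptraceB rho *m delta_mx j i).
set y := \tr (ptraceA rho *m delta_mx k l).
have yJ : y^* = ptraceA rho k l.
  by rewrite /y mxtrace_mul_delta -mxdagE psd_herm //; case: dsB.
have xE : x = ptraceB rho i j by rewrite /x mxtrace_mul_delta.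
have cX : \tr (ptraceB rho *m (delta_mx j i - x%:M)) = 0.
  rewrite mulmxBr raddfB /= -/x mul_mx_scalar mxtraceZ.
  by case: dsA => _ ->; rewrite mulr1 subrr.
have cY : \tr (ptraceA rho *m (delta_mx k l - y%:M)) = 0.
  rewrite mulmxBr raddfB /= -/y mul_mx_scalar mxtraceZ.
  by case: dsB => _ ->; rewrite mulr1 subrr.
have := corr_le_maxcorr psdr cX cY.
have -> : \tr (rho *m ((delta_mx j i - x%:M) *t dag (delta_mx k l - y%:M))) =
    rho (mxtens_index (i, k)) (mxtens_index (j, l)) -
    (ptraceB rho *t ptraceA rho) (mxtens_index (i, k)) (mxtens_index (j, l)).
  have -> : dag (delta_mx k l - y%:M) = delta_mx l k - y^*%:M :> 'M[C]_dB.
    rewrite mxdagB mxdag_scalar; congr (_ - _).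
    by apply/matrixP => p q; rewrite !mxE andbC rmorph_nat.
  rewrite tensmx_centered delta_mx_tens mulmxDr 2!mulmxBr mxtraceD 2!raddfB /=.
  rewrite -2!scalemxAr mul_mx_scalar 3!mxtraceZ trr mxtrace_mul_delta.
  rewrite -mxtrace_ptraceA -mxtrace_ptraceB !mxtrace_mul_delta tensmxE yJ -xE.
  ring.
move=> h; rewrite -ler_sqr ?nnegrE ?normr_ge0 ?lecR ?maxcorr_ge0 //.
apply: le_trans h _; rewrite ler_piMr ?exprn_ge0 ?lecR ?maxcorr_ge0 //.
by rewrite mulr_ile1 ?variance_delta_le1 // psd_trace_mul_ge0 //;
  [case: dsA | case: dsB].
Qed.

(** Correlations factor on a product state and the first factor vanishes by centering. The feasible
    values thus form the empty set or [{0}], both with [sup] equal to 0. *)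
Lemma maxcorr_tens X Y : density X -> density Y -> maxcorr (X *t Y) = 0.
Proof.
move=> [_ tX] [_ tY]; rewrite /maxcorr; set S := (Z in sup Z).
have : (S `<=` [set 0])%classic.
  move=> _ [X' [Y' [+ _ _ _ ->]]]; rewrite ptraceB_tens tY scale1r => h.
  by rewrite tensmx_mul mxtrace_tens h mul0r normr0.
by move=> /subset_set1[|] ->; rewrite ?sup0 ?sup1.
Qed.

End Bipartite.

(** A separable decomposition is admissible with value 0, and no value is negative since the
    iterated maximum starts at 0. *)
Lemma separable_maxent0 dA dB (rho : 'M[C]_(dA * dB)) : separable rho -> maxent rho = 0.
Proof.
move=> [n [p [tA [tB [p0 p1 dA' dB' ->]]]]]; apply/le_anti/andP; split.
  apply: ge_inf.
    by exists 0 => _ [m [q [tau [_ _ _ ->]]]]; exact: bigmax_ge_id.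
  exists n, p, (fun i => tA i *t tB i); split => //.
    by move=> i; exact: density_tens.
  apply/le_anti/andP; split; first exact: bigmax_ge_id.
  by apply: bigmax_le => // i _; rewrite maxcorr_tens.
apply: lb_le_inf.
  exists (\big[Num.max/0]_(i < n) maxcorr (tA i *t tB i)), n, p, (fun i => tA i *t tB i).
  by split => // i; exact: density_tens.
by move=> _ [m [q [tau [_ _ _ ->]]]]; exact: bigmax_ge_id.
Qed.

End MaximalCorrelation.

(** * Caratheodory's theorem for convex cones *)

Section Caratheodory.
Variables (R : realFieldType) (T : Type) (D : nat) (F : T -> 'rV[R]_D).

(** More than [D] vectors admit a linear relation [u], with some positive coefficient up to sign.
    Subtracting the multiple of [u] given by the least ratio [p i / u i] over positive [u i] keeps
    all weights nonnegative and cancels one. *)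
Lemma conic_dependence n (p : 'I_n -> R) (x : 'I_n -> T) :
  (D < n)%N -> (forall i, 0 <= p i) ->
  exists (q : 'I_n -> R) (i0 : 'I_n), [/\ forall i, 0 <= q i, q i0 = 0 &
    \sum_i q i *: F (x i) = \sum_i p i *: F (x i)].
Proof.
move=> ltDn p0; pose A := \matrix_i F (x i).
have [u uA [i ui]] : exists2 u : 'rV[R]_n, u *m A = 0 & exists i, 0 < u 0 i.
  have : kermx A != 0.
    rewrite -mxrank_eq0 mxrank_ker -lt0n subn_gt0.
    by rewrite (leq_ltn_trans (rank_leq_col A)).
  move=> /rowV0Pn[u /sub_kermxP uA un0].
  have [i ui] : exists i, u 0 i != 0.
    apply: contrapT => /forallNP h; case/eqP: un0; apply/rowP => i.
    by rewrite mxE; apply/eqP/negPn/negP/h.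
  have [ui0|ui0|/eqP] := ltgtP (u 0 i) 0; last by rewrite (negbTE ui).
    exists (- u); first by rewrite mulNmx uA oppr0.
    by exists i; rewrite mxE oppr_gt0.
  by exists u => //; exists i.
have [i0 ui0 mini] : exists2 i0, 0 < u 0 i0 &
    forall i, 0 < u 0 i -> p i0 / u 0 i0 <= p i / u 0 i.
  by case: (@arg_minP _ _ _ i (fun i => 0 < u 0 i) (fun i => p i / u 0 i) ui) => i0;
    exists i0.
exists (fun i => p i - p i0 / u 0 i0 * u 0 i), i0; split.
- move=> j; rewrite subr_ge0; have [uj|uj] := ltrP 0 (u 0 j).
    by rewrite -ler_pdivlMr // mini.
  by rewrite (le_trans _ (p0 j)) // mulr_ge0_le0 // divr_ge0 // ltW.
- by rewrite divfK ?gt_eqF // subrr.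
have uF : \sum_i u 0 i *: F (x i) = 0.
  rewrite -[RHS]uA mulmx_sum_row; apply: eq_bigr => j _.
  by rewrite rowK.
under eq_bigr do rewrite scalerBl -scalerA.
by rewrite sumrB -scaler_sumr uF scaler0 subr0.
Qed.

(** Removing one index at a time leaves at most [D] terms. The conic form preserves only the vector
    sum; the total weight is recovered later from the trace. Exactly [D] terms are produced, so that
    a sequence of such combinations shares one index type. *)
Lemma conic_Caratheodory n (p : 'I_n -> R) (x : 'I_n -> T) (x0 : T) :
  (forall i, 0 <= p i) ->
  exists (q : 'I_D -> R) (y : 'I_D -> T), (forall i, 0 <= q i) /\
    \sum_i q i *: F (y i) = \sum_i p i *: F (x i).
Proof.
have pad m (q : 'I_m -> R) (y : 'I_m -> T) : (m <= D)%N ->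
    (forall i, 0 <= q i) ->
    exists (q' : 'I_D -> R) (y' : 'I_D -> T), (forall i, 0 <= q' i) /\
      \sum_i q' i *: F (y' i) = \sum_i q i *: F (y i).
  (* Indices beyond [m] get weight 0 and the dummy point [x0]. *)
  move=> leqD q0; pose o (i : 'I_D) : option 'I_m := insub (val i).
  exists (fun i => oapp q 0 (o i)), (fun i => oapp y x0 (o i)); split.
    by move=> i; case: (o i) => /=.
  pose G i := oapp q 0 (insub i) *: F (oapp y x0 (insub i)).
  transitivity (\sum_(i < m) G i); last first.
    by apply: eq_bigr => i _; rewrite /G valK.
  rewrite (big_ord_widen D G leqD) [RHS]big_mkcond; apply: eq_bigr => i _.
  by rewrite /G /o; case: insubP => [j -> _ //|/negbTE ->] /=; rewrite scale0r.
elim: n p x => [|n IHn] p x p0; first exact: pad.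
have [leDn|ltnD] := ltnP D n.+1; last exact: pad.
have [q [i0 [q0 qi0 <-]]] := conic_dependence x leDn p0.
have [r [y [r0 e]]] := IHn (q \o lift i0) (x \o lift i0) (fun i => q0 _).
exists r, y; split => //; rewrite e (bigD1_ord i0) //= qi0 scale0r add0r //.
Qed.

End Caratheodory.

(** * Limits of sequences along an ultrafilter *)

Section UltraLimit.
Variables (C : numClosedFieldType) (U : set_system nat).
Hypothesis UU : UltraFilter U.
Let PU : ProperFilter U := @ultra_proper _ _ UU.
Local Existing Instance PU.
Implicit Types (u v : nat -> C) (a b : C).

(** Here [0 < e] in [C] forces [e] to be real, so this is ordinary convergence along [U]. *)
Definition ultralim u a := forall e : C, 0 < e -> U [set k | `|u k - a| <= e]%classic.

Lemma ultralim_cst a : ultralim (fun=> a) a.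
Proof.
by move=> e e0; apply: filterS filterT => k _ /=; rewrite subrr normr0 ltW.
Qed.

Lemma ultralimD u v a b : ultralim u a -> ultralim v b ->
  ultralim (fun k => u k + v k) (a + b).
Proof.
move=> ua vb e e0; have e2 : 0 < e / 2 by rewrite divr_gt0.
apply: filterS2 (ua _ e2) (vb _ e2) => k /= h1 h2.
have -> : u k + v k - (a + b) = (u k - a) + (v k - b) by ring.
by rewrite (le_trans (ler_normD _ _)) // [leRHS]splitr lerD.
Qed.

Lemma ultralimM u v a b : ultralim u a -> ultralim v b ->
  ultralim (fun k => u k * v k) (a * b).
Proof.
(* With [d = e / c] the error is at most [d (1 + |b| + |a|)], below [d c = e]; the summand [e] in
   [c] ensures [d <= 1], which absorbs the quadratic term. *)
move=> ua vb e e0; pose c := `|a| + `|b| + 1 + e.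
have c0 : 0 < c by rewrite ltr_wpDl ?addr_ge0.
have d0 : 0 < e / c by rewrite divr_gt0.
have d1 : e / c <= 1 by rewrite ler_pdivrMr // mul1r lerDr !addr_ge0.
apply: filterS2 (ua _ d0) (vb _ d0) => k /= h1 h2.
have -> : u k * v k - a * b = (u k - a) * (v k - b) + (u k - a) * b + a * (v k - b) by ring.
apply: (@le_trans _ _ (e / c * 1 + e / c * `|b| + `|a| * (e / c))); last first.
  have {4}-> : e = e / c * c by rewrite divfK ?gt_eqF.
  rewrite [`|a| * _]mulrC -!mulrDr.
  apply: ler_wpM2l; first exact: ltW.
  rewrite -subr_ge0 /c.
  have -> : `|a| + `|b| + 1 + e - (1 + `|b| + `|a|) = e by ring.
  exact: ltW.
rewrite (le_trans (ler_normD _ _)) // normrM lerD ?ler_wpM2l //.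
rewrite (le_trans (ler_normD _ _)) // !normrM lerD ?ler_wpM2r //.
by rewrite ler_pM // (le_trans h2).
Qed.

Lemma ultralim_sum n (u : 'I_n -> nat -> C) (a : 'I_n -> C) :
  (forall i, ultralim (u i) (a i)) ->
  ultralim (fun k => \sum_i u i k) (\sum_i a i).
Proof.
move=> ua; elim: (index_enum _) => [|i r IHr].
  have -> : (fun k => \sum_(i <- [::]) u i k) = fun=> 0.
    by apply/funext => k; rewrite big_nil.
  by rewrite big_nil; exact: ultralim_cst.
have -> : (fun k => \sum_(j <- i :: r) u j k) = fun k => u i k + \sum_(j <- r) u j k.
  by apply/funext => k; rewrite big_cons.
by rewrite big_cons; exact: ultralimD.
Qed.

Lemma ultralim_norm u a : ultralim u a -> ultralim (fun k => `|u k|) `|a|.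
Proof.
move=> ua e /ua; apply: filterS => k /=; apply: le_trans.
exact: ler_dist_dist.
Qed.

Lemma ultralim_unique u a b : ultralim u a -> ultralim u b -> a = b.
Proof.
move=> ua ub; apply/eqP; rewrite -subr_eq0 -normr_eq0; apply: contraT => ab.
(* A third rather than a half, because the neighbourhoods are closed. *)
have e0 : 0 < `|a - b| / 3 by rewrite divr_gt0 // lt_def ab normr_ge0.
have [k [/= h1 h2]] := filter_ex (filterI (ua _ e0) (ub _ e0)).
have : `|a - b| <= `|a - b| / 3 + `|a - b| / 3.
  have {1}-> : a - b = (a - u k) + (u k - b) by ring.
  by rewrite (le_trans (ler_normD _ _)) // lerD // distrC.
rewrite -subr_le0; have -> : `|a - b| - (`|a - b| / 3 + `|a - b| / 3) = `|a - b| / 3.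
  by field.
by rewrite lt_geF.
Qed.

(** The sequence equals its norm, so its limit does too; this yields realness and sign at once. *)
Lemma ultralim_ge0 u a : ultralim u a -> (forall k, 0 <= u k) -> 0 <= a.
Proof.
move=> ua u0; have := ultralim_norm ua.
have -> : (fun k => `|u k|) = u by apply/funext => k; rewrite ger0_norm.
by move=> /(ultralim_unique ua) ->.
Qed.

End UltraLimit.

(** * Bounded sequences converge along an ultrafilter *)

Section BoundedUltraLimit.
Variables (R : realType) (U : set_system nat).
Hypothesis UU : UltraFilter U.
Let PU : ProperFilter U := @ultra_proper _ _ UU.
Local Existing Instance PU.
Local Notation C := R[i].

(** The limit is the supremum of the reals [x] with [x <= u k] for [U]-almost all [k]. *)
Lemma bounded_real_ultralim (u : nat -> R) : (forall k, `|u k| <= 1) ->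
  exists l, ultralim U (fun k => (u k)%:C%C) l%:C%C.
Proof.
move=> u1; pose S := [set x : R | U [set k | x <= u k]]%classic.
have ubS : ubound S 1.
  move=> x Sx; have [k /= xk] := filter_ex Sx.
  by rewrite (le_trans xk) // (le_trans (ler_norm _)).
have hS : has_sup S.
  split; last by exists 1.
  exists (-1); apply: filterS filterT => k _ /=.
  by have := u1 k; rewrite ler_norml => /andP[].
exists (sup S) => e; rewrite ltcE => /andP[/eqP/= e1 e0].
have -> : e = (complex.Re e)%:C%C by case: e e1 {e0} => x y /= ->.
move: (complex.Re e) e0 => {e1}d d0.
have [x Sx ltx] := sup_adherent d0 hS.
have lo : U [set k | sup S - d <= u k]%classic.
  by apply: filterS Sx => k /=; apply: le_trans; exact: ltW.
(* The ultrafilter dichotomy enters here: if the set itself were in [U], then [sup S + d] would lie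
   in [S]. *)
have hi : U (~` [set k | sup S + d <= u k])%classic.
  have [h|//] := in_ultra_setVsetC [set k | sup S + d <= u k]%classic UU.
  have := ub_le_sup hS.2 h; by rewrite gerDl leNgt d0.
apply: filterS2 lo hi => k /= h1 /negP; rewrite -ltNge => h2.
rewrite -rmorphB normc_def /= expr0n addr0 sqrtr_sqr lecR ler_norml.
by apply/andP; split; lra.
Qed.

Lemma bounded_ultralim (u : nat -> C) : (forall k, `|u k| <= 1) ->
  exists l, ultralim U u l.
Proof.
move=> u1.
have [k|a ua] := bounded_real_ultralim (u := fun k => complex.Re (u k)).
  by rewrite -lecR (le_trans (normc_ge_Re _)) //.
have [k|b ub] := bounded_real_ultralim (u := fun k => complex.Im (u k)).
  rewrite -lecR (le_trans _ (u1 k)) // normc_def -sqrtr_sqr lecR.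
  by rewrite ler_sqrt ?addr_ge0 ?sqr_ge0 // lerDr sqr_ge0.
exists (a%:C%C + 'i%C * b%:C%C).
have -> : u = fun k => (complex.Re (u k))%:C%C + 'i%C * (complex.Im (u k))%:C%C.
  by apply/funext => k; rewrite -complexE.
by apply: ultralimD => //; apply: ultralimM => //; exact: ultralim_cst.
Qed.

End BoundedUltraLimit.

(** * Approximation by bounded-length separable sums, and passage to the limit *)

Section Closedness.
Variable R : realType.
Local Notation C := R[i].
Local Notation dag := (@mxdag R _ _).

(** Real coordinates, since Caratheodory's theorem is applied with real nonnegative weights. *)
Definition realify m n (M : 'M[C]_(m, n)) : 'rV[R]_(m * n + m * n) :=
  row_mx (mxvec (\matrix_(i, j) complex.Re (M i j)))
         (mxvec (\matrix_(i, j) complex.Im (M i j))).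

Lemma realify_inj m n : injective (@realify m n).
Proof.
move=> M N /eq_row_mx[/(can_inj mxvecK)/matrixP eRe /(can_inj mxvecK)/matrixP eIm].
apply/matrixP => i j; have := eRe i j; have := eIm i j; rewrite !mxE.
by case: (M i j) (N i j) => a b [c d] /= -> ->.
Qed.

Lemma realify_comb m n k (p : 'I_k -> R) (M : 'I_k -> 'M[C]_(m, n)) :
  realify (\sum_i (p i)%:C%C *: M i) = \sum_i p i *: realify (M i).
Proof.
have realifyD (A B : 'M[C]_(m, n)) : realify (A + B) = realify A + realify B.
  rewrite /realify add_row_mx -!linearD /=; congr (row_mx (mxvec _) (mxvec _));
  by apply/matrixP => i j; rewrite !mxE; case: (A i j) (B i j) => a b [].
have realifyZ (q : R) (A : 'M[C]_(m, n)) : realify (q%:C%C *: A) = q *: realify A.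
  rewrite /realify scale_row_mx -!linearZ /=; congr (row_mx (mxvec _) (mxvec _));
  by apply/matrixP => i j; rewrite !mxE; case: (A i j) => a b /=; ring.
have realify0 : realify (0 : 'M[C]_(m, n)) = 0.
  by apply: (addrI (realify 0)); rewrite -realifyD !addr0.
elim/big_rec2: _ => // i M' N _ <-; by rewrite realifyD realifyZ.
Qed.

Lemma mxtrace_density_comb n k (p : 'I_k -> R) (M : 'I_k -> 'M[C]_n) :
  (forall i, density (M i)) ->
  \tr (\sum_i (p i)%:C%C *: M i) = (\sum_i p i)%:C%C.
Proof.
move=> dM; rewrite raddf_sum rmorph_sum; apply: eq_bigr => i _.
by rewrite /= mxtraceZ; case: (dM i) => _ ->; rewrite mulr1.
Qed.

Section Bipartite.
Variables (dA dB : nat).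
(** The label type for Caratheodory's theorem: selecting labels instead of matrices keeps track of
    the factors. *)
Let T := {AB : 'M[C]_dA * 'M[C]_dB | density AB.1 /\ density AB.2}.
Let tens (y : T) : 'M[C]_(dA * dB) := (sval y).1 *t (sval y).2.
Let D := (dA * dB * (dA * dB) + dA * dB * (dA * dB))%N.

Lemma density_tens_sig (y : T) : density (tens y).
Proof. by case: y => [[A B] [/= hA hB]]; exact: density_tens. Qed.

Lemma maxent_approx (rho : 'M[C]_(dA * dB)) (e : R) :
  density rho -> maxent rho = 0 -> 0 < e ->
  exists (q : 'I_D -> R) (y : 'I_D -> T), [/\ forall i, 0 <= q i, \sum_i q i = 1 &
    forall a b, `|rho a b - (\sum_i (q i)%:C%C *: tens (y i)) a b| <= e%:C%C].
Proof.
move=> dr + e0; rewrite /maxent; set S := (X in inf X) => S0.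
have [_ [n [p [tau [p0 dtau rhoE ->]]]] lt_e] : exists2 r, S r & r < e.
  apply: inf_lt; last by rewrite S0.
  (* The one-term decomposition makes [S] nonempty, so some value lies below [e]. *)
  exists (\big[Num.max/0]_(i < 1) maxcorr rho), 1%N, (fun=> 1), (fun=> rho).
  by split => //; rewrite big_ord1 scale1r.
pose x i : T := exist _ (ptraceB (tau i), ptraceA (tau i))
  (conj (density_ptraceB (dtau i)) (density_ptraceA (dtau i))).
pose x0 : T := exist _ (ptraceB rho, ptraceA rho)
  (conj (density_ptraceB dr) (density_ptraceA dr)).
(* [maxent] asks only for nonnegative weights; comparing traces normalises them. *)
have p1 : \sum_i p i = 1.
  apply: (@complexI R); rewrite -(mxtrace_density_comb p dtau) -rhoE.
  exact: dr.2.
have [q [y [q0 qy]]] := conic_Caratheodory (fun y => realify (tens y)) x x0 p0.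
have {}qy : \sum_i (q i)%:C%C *: tens (y i) = \sum_i (p i)%:C%C *: tens (x i).
  by apply: realify_inj; rewrite !realify_comb.
exists q, y; split => //.
  (* Both combinations are the same matrix and all terms have trace 1, so the total weights
     agree. *)
  apply: (@complexI R); rewrite -p1.
  rewrite -(mxtrace_density_comb p (fun i => density_tens_sig (x i))).
  by rewrite -qy (mxtrace_density_comb q (fun i => density_tens_sig (y i))).
move=> a b; rewrite qy rhoE.
(* Writing [e] as the sum of the [p i * e] reduces the bound to a termwise one. *)
rewrite -[e%:C%C]mul1r -(rmorph1 (real_complex R)) -p1 rmorph_sum mulr_suml.
rewrite !summxE -sumrB (le_trans (ler_norm_sum _ _ _)) // ler_sum // => i _.
rewrite ![fun_of_matrix (_ *: _) _ _]mxE -mulrBr normrM ger0_norm ?ler0c //.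
rewrite ler_wpM2l ?ler0c //.
apply: le_trans (maxcorr_entry a b (dtau i)) _.
by rewrite lecR (le_trans _ (ltW lt_e)) // le_bigmax.
Qed.

End Bipartite.

Section Limits.
Variable U : set_system nat.
Hypothesis UU : UltraFilter U.

(** Compactness of the set of states: bounded entries have limits, and the quadratic form and the
    trace are finite sums of products of entries and constants, so positivity and normalisation
    survive. *)
Lemma density_ultralim n (A : nat -> 'M[C]_n) : (forall k, density (A k)) ->
  exists2 B : 'M[C]_n, density B &
    forall i j, ultralim U (fun k => A k i j) (B i j).
Proof.
move=> dA.
have /choice[f fP] : forall ij : 'I_n * 'I_n,
    exists l, ultralim U (fun k => A k ij.1 ij.2) l.
  by move=> ij; apply: bounded_ultralim => // k; exact: density_entry_le1.
pose B : 'M[C]_n := \matrix_(i, j) f (i, j).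
have BP i j : ultralim U (fun k => A k i j) (B i j) by rewrite mxE; exact: fP (i, j).
exists B => //; split.
  move=> v; apply: (@ultralim_ge0 _ _ UU (fun k => (dag v *m A k *m v) 0 0)); last first.
    by move=> k; case: (dA k).
  have E (M : 'M[C]_n) : (dag v *m M *m v) 0 0 = \sum_j \sum_i dag v 0 i * M i j * v j 0.
    by rewrite mxE; apply: eq_bigr => j _; rewrite mxE mulr_suml.
  rewrite E; under eq_fun do rewrite E.
  apply: ultralim_sum => // j; apply: ultralim_sum => // i.
  apply: ultralimM => //; last exact: ultralim_cst.
  by apply: ultralimM => //; exact: ultralim_cst.
apply: (@ultralim_unique _ _ UU (fun k => \tr (A k))).
  by rewrite /mxtrace; apply: ultralim_sum.
have -> : (fun k => \tr (A k)) = fun=> 1 by apply/funext => k; case: (dA k).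
exact: ultralim_cst.
Qed.

End Limits.

Lemma maxent0_separable dA dB (rho : 'M[C]_(dA * dB)) :
  density rho -> maxent rho = 0 -> separable rho.
Proof.
move=> dr rho0.
have /choice[q /choice[y P]] := fun k : nat =>
  maxent_approx dr rho0 (divr_gt0 ltr01 (ltr0Sn R k)).
(* [U] refines the filter of cofinite tails, so ordinary limits are also limits along [U]. *)
have [U [UU sU]] := @ultraFilterLemma _ \oo%classic _.
set D := addn _ _ in q y P.
have /choice[A AP] : forall i : 'I_D, exists M : 'M[C]_dA, density M /\
    forall a b, ultralim U (fun k => (sval (y k i)).1 a b) (M a b).
  move=> i; have [k|M dM hM] := density_ultralim UU (A := fun k => (sval (y k i)).1).
    by case: (svalP (y k i)).
  by exists M.
have /choice[B BP] : forall i : 'I_D, exists M : 'M[C]_dB, density M /\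
    forall a b, ultralim U (fun k => (sval (y k i)).2 a b) (M a b).
  move=> i; have [k|M dM hM] := density_ultralim UU (A := fun k => (sval (y k i)).2).
    by case: (svalP (y k i)).
  by exists M.
have /choice[p pP] : forall i : 'I_D, exists l : R,
    ultralim U (fun k => (q k i)%:C%C) l%:C%C.
  move=> i; apply: bounded_real_ultralim => // k; have [q0 q1 _] := P k.
  by rewrite ger0_norm // -q1 (bigD1 i) //= lerDl sumr_ge0.
have rhoE : rho = \sum_i (p i)%:C%C *: (A i *t B i).
  apply/esym/matrixP => a b.
  (* The approximants tend to [rho] by the error bound and to the limiting sum by continuity of sums
     and products. *)
  apply: (@ultralim_unique _ _ UU (fun k => (\sum_i (q k i)%:C%C *:
    ((sval (y k i)).1 *t (sval (y k i)).2)) a b)); last first.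
    move=> e; rewrite ltcE => /andP[/eqP/= e1 e0].
    have -> : e = (complex.Re e)%:C%C by case: e e1 {e0} => x z /= ->.
    (* Beyond an integer bound for [1 / e] the error [1 / (k + 1)] is at most [e]. *)
    apply: sU; exists (Num.bound (complex.Re e)^-1) => // k /= kN.
    have [_ _ /(_ a b)] := P k; rewrite distrC => /le_trans; apply.
    have := @archi_boundP R (complex.Re e)^-1; rewrite invr_ge0 => /(_ (ltW e0)) h.
    rewrite lecR div1r invf_ple ?posrE ?ltr0Sn //; apply: le_trans (ltW h) _.
    by rewrite ler_nat ltnW.
  rewrite summxE; under eq_fun do rewrite summxE.
  apply: ultralim_sum => // i; rewrite mxE; under eq_fun do rewrite mxE.
  apply: ultralimM => //; case: (mxtens_indexP a) => i1 k1.
  case: (mxtens_indexP b) => j1 l1; rewrite tensmxE.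
  under eq_fun do rewrite tensmxE.
  by apply: ultralimM => //; [case: (AP i) | case: (BP i)].
exists D, p, A, B; split => //.
- move=> i; rewrite -lecR; apply: (ultralim_ge0 UU (pP i)) => k.
  by rewrite lecR; case: (P k).
- apply: (@complexI R).
  rewrite -(mxtrace_density_comb p (M := fun i => A i *t B i)) -?rhoE; first by case: dr.
  by move=> i; apply: density_tens; [case: (AP i) | case: (BP i)].
- by move=> i; case: (AP i).
- by move=> i; case: (BP i).
Qed.

End Closedness.

Theorem theorem6 (R : realType) (dA dB : nat) (rho : 'M[R[i]]_(dA * dB)) :
  density rho -> (maxent rho = 0 <-> separable rho).
Proof. by move=> dr; split; [exact: maxent0_separable | exact: separable_maxent0]. Qed.
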